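(* Let $\mathbb U$ and $\mathbb V$ be Banach spaces and let $B:\mathbb U\to\mathbb V^*$ be a linear, continuous and bounded-below operator (i.e. there is $\gamma_B>0$ with $\|Bw\|_{\mathbb V^*}\ge\gamma_B\|w\|_{\mathbb U}$ for all $w\in\mathbb U$). Assume additionally that $\mathbb V$ and $\mathbb V^*$ are strictly convex and reflexive, and let $J_{\mathbb V}:\mathbb V\to\mathbb V^*$ be the (single-valued, bijective) duality map. Let $f\in\mathbb V^*$ and let $\mathbb U_n\subset\mathbb U$ be a finite-dimensional subspace. Then, for $u_n\in\mathbb U_n$, the following statements are equivalent: (i) $u_n$ is the unique residual minimizer: $u_n=\arg\min_{w_n\in\mathbb U_n}\|f-Bw_n\|_{\mathbb V^*}$. (ii) $u_n$ is the solution of the nonlinear Petrov--Galerkin formulation $$\langle\nu_n,J_{\mathbb V}^{-1}(f-Bu_n)\rangle_{\mathbb V^*,\mathbb V}=0\qquad\forall \nu_n\in B\mathbb U_n .$$ (iii) There is a unique $r\in\mathbb V$ such that $(r,u_n)$ satisfies the semi-infinite mixed formulation $$\langle J_{\mathbb V}(r),v\rangle_{\mathbb V^*,\mathbb V}+\langle Bu_n,v\rangle_{\mathbb V^*,\mathbb V}=\langle f,v\rangle_{\mathbb V^*,\mathbb V}\quad\forall v\in\mathbb V,\qquad \langle Bw_n,r\rangle_{\mathbb V^*,\mathbb V}=0\quad\forall w_n\in\mathbb U_n .$$ (iv) $u_n$ is the Lagrange multiplier of the constrained minimization problem $$\min_{v\in(B\mathbb U_n)^\perp}\ \tfrac12\|v\|_{\mathbb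 V}^2-\langle f,v\rangle_{\mathbb V^*,\mathbb V}.$$
   Context: All spaces are real. For a normed space $\mathbb Y$, the duality mapping is $\mathcal J_{\mathbb Y}(y)=\{y^*\in\mathbb Y^*:\langle y^*,y\rangle=\|y\|_{\mathbb Y}^2=\|y^*\|_{\mathbb Y^*}^2\}$. A normed space is strictly convex if $\|\theta y_1+(1-\theta)y_2\|<1$ whenever $y_1\ne y_2$, $\|y_1\|=\|y_2\|=1$, $\theta\in(0,1)$. If $\mathbb Y^*$ is strictly convex, $\mathcal J_{\mathbb Y}$ is single-valued and one writes $\mathcal J_{\mathbb Y}(y)=\{J_{\mathbb Y}(y)\}$; if $\mathbb Y$ and $\mathbb Y^*$ are strictly convex and reflexive Banach spaces, $J_{\mathbb Y}:\mathbb Y\to\mathbb Y^*$ is a bijection (known fact). $(B\mathbb U_n)^\perp:=\{v\in\mathbb V:\langle Bw_n,v\rangle_{\mathbb V^*,\mathbb V}=0\ \forall w_n\in\mathbb U_n\}$. The Lagrangian of the constrained problem is $\mathcal L(v,w_n):=\tfrac12\|v\|_{\mathbb V}^2-\langle f,v\rangle_{\mathbb V^*,\mathbb V}+\langle Bw_n,v\rangle_{\mathbb V^*,\mathbb V}$ on $\mathbb V\times\mathbb U_n$; ''$u_n$ is the Lagrange multiplier'' means that there is $r\in\mathbb V$ such that $(r,u_n)$ is a saddle point: $\mathcal L(r,w_n)\le\mathcal L(r,u_n)\le\mathcal L(v,u_n)$ for all $(v,w_n)\in\mathbb V\times\mathbb U_n$. *)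

(* Defs.v *)
From HB Require Import structures.
From mathcomp Require Import all_boot all_order all_algebra.
From mathcomp Require Import all_classical all_reals.
From mathcomp Require Import topology normedtype.

Set Implicit Arguments.
Unset Strict Implicit.
Unset Printing Implicit Defensive.

Import Order.TTheory GRing.Theory Num.Theory.
Import numFieldNormedType.Exports.

Local Open Scope classical_set_scope.
Local Open Scope ring_scope.

(* The topological dual [cdual V] of a real normed space V, with its operator
   norm, is built as a normed module, so that strict convexity, duality maps,
   continuity and the dual itself are available on it by instantiation. *)

Section topological_dual.
Context (R : realType) (V : normedModType R).

Definition linear_continuous : {pred V -> R^o} :=
  [pred phi : V -> R^o | `[< linear phi /\ continuous phi >]].

Lemma linear_continuous_submod_closed : submod_closed linear_continuous.
Proof.
split=> [|a phi psi].
  apply/asboolP; split; last by move=> x; exact: cvg_cst.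
  by move=> a x y; rewrite scaler0 addr0.
move=> /asboolP[lphi cphi] /asboolP[lpsi cpsi]; apply/asboolP; split.
  move=> b x y /=; rewrite !fctE lphi lpsi !scalerDr !scalerA (mulrC a b).
  by rewrite addrACA.
move=> x; apply: (@cvgD _ _ _ _ _ (fun x => a *: phi x) psi); last exact: cpsi.
by apply: cvgZl_tmp; exact: cphi.
Qed.

HB.instance Definition _ := GRing.isSubmodClosed.Build R (V -> R^o)
  linear_continuous linear_continuous_submod_closed.

Record cdual := CDual {
  cdual_fun :> V -> R^o ;
  _ : cdual_fun \in linear_continuous }.

HB.instance Definition _ := [isSub for cdual_fun].
HB.instance Definition _ := [Choice of cdual by <:].
HB.instance Definition _ := [SubChoice_isSubLmodule of cdual by <:].

Lemma cdual_is_linear (phi : cdual) : linear phi.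
Proof. by case: phi => phi /= /asboolP[]. Qed.

HB.instance Definition _ (phi : cdual) :=
  GRing.isLinear.Build R V R^o *:%R phi (cdual_is_linear phi).

Lemma cdual_continuous (phi : cdual) : continuous phi.
Proof. by case: phi => phi /= /asboolP[]. Qed.

Definition dual_norm (phi : cdual) : R :=
  sup [set `|phi v| | v in [set v | `|v| <= 1]].

Lemma dual_norm_has_sup (phi : cdual) :
  has_sup [set `|phi v| | v in [set v | `|v| <= 1]].
Proof.
split; first by exists `|phi 0|; exists 0 => //=; rewrite normr0.
have /bounded_funP/(_ 1)[M phiM] : bounded_near phi (nbhs (0 : V)).
  exact/linear_bounded_continuous/cdual_continuous.
by exists M => _ [v /= v1 <-]; exact: phiM.
Qed.

Lemma le_dual_norm (phi : cdual) (v : V) : `|phi v| <= dual_norm phi * `|v|.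
Proof.
have [->|v0] := eqVneq v 0; first by rewrite linear0 !normr0 mulr0.
rewrite -ler_pdivrMr ?normr_gt0//.
apply: sup_upper_bound; first exact: dual_norm_has_sup.
exists (`|v|^-1 *: v) => /=.
  by rewrite normrZ normfV normr_id mulVf// normr_eq0.
by rewrite linearZ normrZ normfV normr_id mulrC.
Qed.

Lemma dual_norm_le (phi : cdual) (M : R) :
  (forall v, `|v| <= 1 -> `|phi v| <= M) -> dual_norm phi <= M.
Proof.
move=> phiM; apply: ge_sup; first by have [] := dual_norm_has_sup phi.
by move=> _ [v /= v1 <-]; exact: phiM.
Qed.

Lemma dual_norm_ge0 (phi : cdual) : 0 <= dual_norm phi.
Proof.
apply: (@le_trans _ _ `|phi 0|) => //.
apply: sup_upper_bound; first exact: dual_norm_has_sup.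
by exists 0 => //=; rewrite normr0.
Qed.

Lemma dual_normD (phi psi : cdual) :
  dual_norm (phi + psi) <= dual_norm phi + dual_norm psi.
Proof.
apply: dual_norm_le => v v1; apply: (le_trans (ler_normD _ _)).
by apply: lerD; (apply: (le_trans (le_dual_norm _ _));
  rewrite ler_piMr ?dual_norm_ge0).
Qed.

Lemma dual_normZ_le (a : R) (phi : cdual) :
  dual_norm (a *: phi) <= `|a| * dual_norm phi.
Proof.
apply: dual_norm_le => v v1; rewrite [(a *: phi) v]/(a *: phi v) normrZ.
apply: ler_wpM2l => //; apply: (le_trans (le_dual_norm _ _)).
by rewrite ler_piMr ?dual_norm_ge0.
Qed.

Lemma dual_normZ (a : R) (phi : cdual) :
  dual_norm (a *: phi) = `|a| * dual_norm phi.
Proof.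
apply/eqP; rewrite eq_le dual_normZ_le /=.
have [->|a0] := eqVneq a 0; first by rewrite normr0 mul0r dual_norm_ge0.
rewrite -ler_pdivlMl ?normr_gt0// -normfV.
by rewrite -{1}(scale1r phi) -(mulVf a0) -scalerA dual_normZ_le.
Qed.

Lemma dual_norm0_eq0 (phi : cdual) : dual_norm phi = 0 -> phi = 0.
Proof.
move=> phi0; apply/val_inj/funext => v; apply/eqP; rewrite -normr_le0.
by apply: (le_trans (le_dual_norm _ _)); rewrite phi0 mul0r.
Qed.

HB.instance Definition _ :=
  Lmodule_isNormed.Build R cdual dual_normD dual_normZ dual_norm0_eq0.

Lemma norm_cdualE (phi : cdual) : `|phi| = dual_norm phi.
Proof. by []. Qed.

End topological_dual.

Section bidual.
Context (R : realType) (V : normedModType R).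

Definition evaluation (v : V) : cdual V -> R^o := fun phi => phi v.

Lemma evaluation_linear_continuous (v : V) :
  evaluation v \in @linear_continuous R (cdual V).
Proof.
apply/asboolP.
have lin : linear (evaluation v) by [].
pose ev : {linear cdual V -> R^o} :=
  HB.pack (evaluation v) (GRing.isLinear.Build _ _ _ _ _ lin).
split=> //; apply: (@bounded_linear_continuous _ _ _ ev); apply/bounded_funP.
move=> r; exists (r * `|v|) => phi phir.
by apply: (le_trans (le_dual_norm _ _)); rewrite ler_wpM2r.
Qed.

Definition bidual_embedding (v : V) : cdual (cdual V) :=
  CDual (evaluation_linear_continuous v).

Definition reflexive_space := range bidual_embedding = setT.

End bidual.

Section geometry.
Context (R : realType).

Definition strictly_convex (Y : normedModType R) := forall (y1 y2 : Y) (t : R),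
  y1 <> y2 -> `|y1| = 1 -> `|y2| = 1 -> 0 < t < 1 ->
  `|t *: y1 + (1 - t) *: y2| < 1.

Definition duality_mapping (Y : normedModType R) (y : Y) : set (cdual Y) :=
  [set phi : cdual Y | phi y = `|y| ^+ 2 /\ `|y| ^+ 2 = `|phi| ^+ 2].

(* [get] chooses an element of a set: [duality_map y] is the element of
   the duality mapping when the latter is a singleton (Y* strictly convex), and
   [duality_map_inv] is the inverse of [duality_map] when the latter is a
   bijection (Y and Y* strictly convex and reflexive). *)
Definition duality_map (Y : normedModType R) (y : Y) : cdual Y :=
  get (duality_mapping y).

Definition duality_map_inv (Y : normedModType R) (phi : cdual Y) : Y :=
  get [set y | duality_map y = phi].

Definition fin_dim_subspace (X : normedModType R) (W : set X) :=
  [/\ W 0, forall (a : R) x y, W x -> W y -> W (a *: x + y) &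
      exists n (e : 'I_n -> X), (forall i, W (e i)) /\
        forall x, W x -> exists c : 'I_n -> R, x = \sum_(i < n) c i *: e i].

Definition bounded_below (X Y : normedModType R) (B : X -> Y) :=
  exists2 gamma : R, 0 < gamma & forall x, gamma * `|x| <= `|B x|.

End geometry.

Definition argmin (R : realType) (T : Type) (A : set T) (F : T -> R) : set T :=
  [set x | A x /\ forall y, A y -> F x <= F y].

(* (x, m) minimizes L in its first argument, over X, and maximizes it in its
   second one, over M. *)
Definition saddle_point (R : realType) (T S : Type) (X : set T) (M : set S)
    (L : T -> S -> R) (x : T) (m : S) :=
  [/\ X x, M m & forall y k, X y -> M k -> L x k <= L x m <= L y m].

Definition lagrangian (R : realType) (U V : normedModType R)
    (B : U -> cdual V) (f : cdual V) (v : V) (w : U) : R :=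
  2^-1 * `|v| ^+ 2 - f v + B w v.

(* Lagrange multipliers of the minimization of |v|^2/2 - f v under the
   constraint that v be annihilated by B w for all w in W. *)
Definition lagrange_multiplier (R : realType) (U V : normedModType R)
    (B : U -> cdual V) (f : cdual V) (W : set U) (u : U) :=
  exists r : V, saddle_point setT W (lagrangian B f) r u.

(* Main.v *)
(** The equation [duality_map r = f - B un] says that f - B un and r are dual
    vectors.  If r also annihilates B(Un), pairing r with f - B w gives
    |f - B un| <= |f - B w|, and strict convexity of the dual makes the
    minimizer unique.  Conversely, if f - B un has minimal norm in its class
    modulo B(Un), Hahn-Banach provides a functional on the dual that norms
    f - B un and vanishes on B(Un); by reflexivity it is the evaluation at some
    r, dual to f - B un.  Saddle points of the Lagrangian are the same pairs
    (r, un) by the equality case of Young's inequality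
    g r <= |g|^2/2 + |r|^2/2.  *)

Require Import Defs.
From HB Require Import structures.
From mathcomp Require Import all_boot all_order all_algebra.
From mathcomp Require Import all_classical all_reals.
From mathcomp Require Import topology normedtype.
From mathcomp Require Import ring lra.

Set Implicit Arguments.
Unset Strict Implicit.
Unset Printing Implicit Defensive.

Import Order.TTheory GRing.Theory Num.Theory.
Import numFieldNormedType.Exports.

Local Open Scope classical_set_scope.
Local Open Scope ring_scope.

(** * Hahn-Banach theorem for a sublinear functional *)

Section hahn_banach.
Context (R : realType) (X : lmodType R) (p : X -> R).
Hypothesis pD : forall x y, p (x + y) <= p x + p y.
Hypothesis pZ : forall (t : R) x, 0 < t -> p (t *: x) = t * p x.

(** Partial linear forms are encoded as relations, so that the upper bound of a chain is its union.
    The empty relation qualifies. *)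
Definition linear_graph (G : set (X * R)) :=
  forall t u v, G u -> G v -> G (t *: u.1 + v.1, t * u.2 + v.2).

(* A nonempty linear graph below a sublinear [p] is functional, because its
   fiber over 0 is a subgroup bounded by [p 0 = 0]: it is the graph of a linear
   form on a subspace. *)
Definition dominated_graph (G : set (X * R)) := forall u, G u -> u.2 <= p u.1.

Lemma linear_graph0 G : linear_graph G -> G !=set0 -> G (0, 0).
Proof.
move=> lG [u Gu]; have := lG (-1) u u Gu Gu.
by rewrite scaleN1r addNr mulN1r addNr.
Qed.

Lemma linear_graphZ G t u : linear_graph G -> G u -> G (t *: u.1, t * u.2).
Proof.
move=> lG Gu; have G0 : G (0, 0) by apply: linear_graph0 => //; exists u.
by have := lG t u (0, 0) Gu G0; rewrite /= !addr0.
Qed.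

Lemma sublinear0 : p 0 = 0.
Proof.
have := @pZ 2 0 (ltr0Sn _ 1); rewrite scaler0 => h; lra.
Qed.

Lemma dominated_graph_fun G x a b : linear_graph G -> dominated_graph G ->
  G (x, a) -> G (x, b) -> a = b.
Proof.
move=> lG dG.
suff le c d : G (x, c) -> G (x, d) -> c <= d.
  by move=> Ga Gb; apply/eqP; rewrite eq_le !le.
move=> Gc Gd; have := dG _ (lG (-1) _ _ Gd Gc).
rewrite /= scaleN1r addNr sublinear0; lra.
Qed.

(** One-dimensional extension, with [c] the value at [x0]. By subadditivity every
    [u.2 - p (u.1 - x0)] lies below every [p (v.1 + x0) - v.2], so the supremum of the former serves
    as [c]; homogeneity reduces [t] to 1 or -1. *)
Lemma dominated_graph_extension G x0 : linear_graph G -> dominated_graph G ->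
  G !=set0 -> exists c, forall u t, G u -> u.2 + t * c <= p (u.1 + t *: x0).
Proof.
move=> lG dG G0.
pose S := [set u.2 - p (u.1 - x0) | u in G].
have ubS v : G v -> ubound S (p (v.1 + x0) - v.2).
  move=> Gv _ [u Gu <-].
  have := dG _ (lG 1 _ _ Gu Gv); rewrite /= scale1r mul1r => h1.
  have := pD (u.1 - x0) (v.1 + x0).
  by rewrite addrACA addNr addr0 => h2; lra.
have [v0 Gv0] := G0.
have supS : has_sup S.
  split; first by exists (v0.2 - p (v0.1 - x0)), v0.
  by exists (p (v0.1 + x0) - v0.2); exact: ubS.
exists (sup S).
have pos u : G u -> u.2 + sup S <= p (u.1 + x0).
  move=> Gu; have := ge_sup (proj1 supS) (ubS _ Gu); lra.
have neg u : G u -> u.2 - sup S <= p (u.1 - x0).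
  move=> Gu; have : S (u.2 - p (u.1 - x0)) by exists u.
  by move/(sup_upper_bound supS); lra.
move=> u t Gu; have [t0|t0|->] := ltgtP t 0; last first.
- by rewrite scale0r mul0r !addr0; exact: dG.
- have := pos _ (linear_graphZ t^-1 lG Gu).
  rewrite -(ler_pM2l t0) -pZ //= mulrDr scalerDr mulrA scalerA.
  by rewrite mulfV ?gt_eqF// mul1r scale1r.
- have nt0 : 0 < - t by rewrite oppr_gt0.
  have := neg _ (linear_graphZ (- t)^-1 lG Gu).
  rewrite -(ler_pM2l nt0) -pZ //= mulrBr scalerBr mulrA scalerA.
  by rewrite mulfV ?gt_eqF// mul1r scale1r mulNr opprK scaleNr opprK.
Qed.

Theorem hahn_banach (G0 : set (X * R)) :
  linear_graph G0 -> dominated_graph G0 -> G0 !=set0 ->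
  exists phi : X -> R^o, [/\ linear phi, forall x, phi x <= p x &
    forall u, G0 u -> phi u.1 = u.2].
Proof.
move=> lG0 dG0 G00.
(* Only nonempty graphs have to contain [G0], so that the union of the empty chain satisfies [P]. *)
pose P G := [/\ linear_graph G, dominated_graph G & G !=set0 -> G0 `<=` G].
have [G [[lG dG GG0] maxG]] : exists G, P G /\ forall H, G `<` H -> ~ P H.
  apply: Zorn_bigcup => F PF totF; split.
  - move=> t u v [A FA Au] [B FB Bv]; have [AB|BA] := totF _ _ FA FB.
      by exists B => //; have [lB _ _] := PF _ FB; apply: lB => //; exact: AB.
    by exists A => //; have [lA _ _] := PF _ FA; apply: lA => //; exact: BA.
  - by move=> u [A FA Au]; have [_ dA _] := PF _ FA; exact: dA.
  - move=> [u [A FA Au]]; have [_ _ AG0] := PF _ FA.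
    by apply: subset_trans (AG0 _) (bigcup_sup FA); exists u.
have Gneq0 : G !=set0.
  apply/set0P/eqP => Ge; apply: (maxG G0); first last.
    by rewrite /P; split=> // _.
  by rewrite Ge; split => // sub; have [u /sub] := G00.
have {}GG0 := GG0 Gneq0.
have domG x : exists a, G (x, a).
  have [c dc] := dominated_graph_extension x lG dG Gneq0.
  (* [H] is the span of [G] and [(x, c)]; maximality of [G] forces [H] into [G]. *)
  pose H := [set w : X * R | exists2 u, G u & exists t,
    w = (u.1 + t *: x, u.2 + t * c)].
  have GH : G `<=` H.
    by move=> [y a] Gu; exists (y, a) => //; exists 0;
      rewrite scale0r mul0r !addr0.
  have HG : H `<=` G.
    apply: contrapT => nHG; apply: (maxG H); first by split.
    split; last by move=> _; exact: subset_trans GH.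
    - move=> t _ _ [u Gu [s ->]] [v Gv [r ->]] /=.
      exists (t *: u.1 + v.1, t * u.2 + v.2); first exact: lG.
      exists (t * s + r) => /=; rewrite scalerDr scalerDl scalerA addrACA.
      by congr (_, _); ring.
    - by move=> _ [u Gu [s ->]] /=; exact: dc.
  exists c; apply: HG; exists (0, 0); first exact: linear_graph0.
  by exists 1; rewrite /= scale1r mul1r !add0r.
have [phi Gphi] := choice domG.
exists phi; split.
- move=> t x y; apply: (dominated_graph_fun lG dG (Gphi _)).
  exact: (lG _ _ _ (Gphi x) (Gphi y)).
- by move=> x; exact: (dG _ (Gphi x)).
- by move=> [x a] /GG0; exact: (dominated_graph_fun lG dG (Gphi _)).
Qed.

End hahn_banach.

(** * Existence, uniqueness and inversion of the duality map *)

Section duality_mapping.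
Context (R : realType).
Implicit Types Y : normedModType R.

Lemma bounded_linear_cdual Y (phi : Y -> R^o) (M : R) : 0 <= M ->
  linear phi -> (forall y, `|phi y| <= M * `|y|) ->
  exists2 psi : cdual Y, psi =1 phi & `|psi| <= M.
Proof.
move=> M0 lphi phiM.
pose f : {linear Y -> R^o} :=
  HB.pack phi (GRing.isLinear.Build _ _ _ _ _ lphi).
have cphi : phi \in @linear_continuous R Y.
  apply/asboolP; split => //.
  apply: (@bounded_linear_continuous _ _ _ f); apply/bounded_funP => r.
  by exists (M * r) => y yr; apply: le_trans (phiM y) _; rewrite ler_wpM2l.
exists (CDual cphi) => //; rewrite norm_cdualE; apply: dual_norm_le => y y1 /=.
by apply: le_trans (phiM y) _; rewrite ler_piMr.
Qed.

Lemma cdual_le_norm Y (phi : cdual Y) y : phi y <= `|phi| * `|y|.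
Proof. exact: le_trans (ler_norm _) (le_dual_norm phi y). Qed.

Lemma duality_mapping_norm Y (y : Y) (phi : cdual Y) :
  duality_mapping y phi -> `|phi| = `|y|.
Proof.
by move=> [_ /eqP]; rewrite eqrXn2// => /eqP.
Qed.

(* The two members of the hypothesis are then equal, by
   [2 * phi y <= 2 * `|y| * `|phi| <= `|y| ^+ 2 + `|phi| ^+ 2]. *)
Lemma duality_mapping_young Y (y : Y) (phi : cdual Y) :
  `|y| ^+ 2 + `|phi| ^+ 2 <= 2 * phi y -> duality_mapping y phi.
Proof.
move=> h; have le := cdual_le_norm phi y.
have e : `|phi| = `|y|.
  apply/eqP; rewrite -subr_eq0 -sqrf_eq0 eq_le sqr_ge0 andbT sqrrB; lra.
have phiyE : phi y = `|y| ^+ 2 :> R by rewrite e in h le; lra.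
by split; rewrite ?e.
Qed.

(** Otherwise, dividing by the common norm would give distinct unit vectors whose midpoint has norm
    at least 1. *)
Lemma strictly_convex_eq Y (x y : Y) : strictly_convex Y ->
  `|x| = `|y| -> 2 * `|x| <= `|x + y| -> x = y.
Proof.
move=> cY xy; apply: contraPP => neq; apply/negP; rewrite -ltNge.
have [x0|x0] := eqVneq x 0.
  move: xy neq; rewrite x0 normr0 => /esym/normr0_eq0 -> //.
have nx : 0 < `|x| by rewrite normr_gt0.
have unit z : `|z| = `|x| -> `| `|x|^-1 *: z| = 1.
  by move=> zx; rewrite normrZ normfV normr_id zx mulVf// gt_eqF.
have := cY (`|x|^-1 *: x) (`|x|^-1 *: y) 2^-1.
rewrite !unit//.
have -> : 1 - 2^-1 = 2^-1 :> R by lra.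
rewrite -!scalerDr !normrZ !normfV !normr_id normr_nat mulrA -invfM.
rewrite ltr_pdivrMl ?mulr_gt0// mulr1 mulrC.
apply => //; last by apply/andP; split; lra.
by move/(scalerI _) => xyE; apply: neq; apply: xyE; rewrite invr_eq0 gt_eqF.
Qed.

(** Both functionals have norm [|y|], and their sum takes the value [2 * |y| ^+ 2] at [y], hence has
    norm at least [2 * |y|] if [y] is nonzero. *)
Lemma duality_mapping_unique Y (y : Y) (phi psi : cdual Y) :
  strictly_convex (cdual Y) -> duality_mapping y phi ->
  duality_mapping y psi -> phi = psi.
Proof.
move=> cY phiy psiy.
have [nphi npsi] := (duality_mapping_norm phiy, duality_mapping_norm psiy).
apply: strictly_convex_eq => //; first by rewrite nphi npsi.
rewrite nphi; have [->|y0] := eqVneq y 0; first by rewrite normr0 mulr0.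
rewrite -(@ler_pM2r _ `|y|) ?normr_gt0//.
apply: le_trans (cdual_le_norm (phi + psi) y).
rewrite [(phi + psi) y]/(phi y + psi y) phiy.1 psiy.1.
by rewrite -mulrA -expr2 mulr_natl mulr2n.
Qed.

Lemma duality_mapping_inj Y (x y : Y) (phi : cdual Y) :
  strictly_convex Y -> duality_mapping x phi ->
  duality_mapping y phi -> x = y.
Proof.
move=> cY phix phiy.
have [nx ny] := (duality_mapping_norm phix, duality_mapping_norm phiy).
apply: strictly_convex_eq => //; first by rewrite -nx.
have [->|x0] := eqVneq x 0; first by rewrite normr0 mulr0.
rewrite -(@ler_pM2l _ `|x|) ?normr_gt0// -[X in _ <= X * _]nx.
apply: le_trans (cdual_le_norm phi (x + y)).
rewrite linearD /= phix.1 phiy.1 -ny nx.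
by rewrite mulrCA -expr2 mulr_natl mulr2n.
Qed.

(** Since 0 is a point of [W] nearest to [g], the form vanishing on [W] with value [|g| ^+ 2] at [g]
    is dominated by [|g|] times the norm; Hahn-Banach extends it. *)
Lemma duality_mapping_annihilator Y (W : set Y) (g : Y) :
  W 0 -> (forall a x y, W x -> W y -> W (a *: x + y)) ->
  (forall w, W w -> `|g| <= `|g - w|) ->
  exists2 phi : cdual Y, duality_mapping g phi & forall w, W w -> phi w = 0.
Proof.
move=> W0 lW gW.
(* The graph of [w + t *: g |-> t * `|g| ^+ 2] on the span of [W] and [g]. *)
pose G0 : set (Y * R) := [set u | exists t, W (u.1 - t *: g) /\
  u.2 = t * `|g| ^+ 2].
have [] := @hahn_banach R Y (fun y => `|g| * `|y|) _ _ G0.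
- by move=> x y; rewrite -mulrDr ler_wpM2l// ler_normD.
- by move=> t x t0; rewrite normrZ gtr0_norm// mulrCA.
- move=> a u v [t [Wu ->]] [s [Wv ->]]; exists (a * t + s) => /=; split.
    by have := lW a _ _ Wu Wv; rewrite scalerBr scalerDl scalerA opprD addrACA.
  by rewrite mulrDl mulrA.
(* For positive [t], [w + t *: g] is [t] times the difference of [g] and a point of [W], so its norm
   is at least [t * |g|]. *)
- move=> u [t [Wu ->]]; have [t0|t0] := leP t 0.
    by apply: (@le_trans _ _ 0); rewrite ?mulr_ge0// mulr_le0_ge0// sqr_ge0.
  rewrite expr2 mulrCA ler_wpM2l//.
  have := gW _ (lW (- t^-1) _ _ Wu W0).
  rewrite addr0 scaleNr opprK scalerBr scalerA mulVf ?gt_eqF// scale1r.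
  rewrite addrC subrK normrZ normfV gtr0_norm//.
  by rewrite -(ler_pM2l t0) mulrA mulfV ?gt_eqF// mul1r.
- by exists (0, 0), 0; rewrite /= scale0r subrr mul0r.
move=> phi [lphi phig phiG0].
have [|y|psi psiE npsi] := @bounded_linear_cdual Y phi `|g| _ lphi.
- by [].
- rewrite ler_norml [X in _ && X]phig andbT lerNl.
  have := zmod_morphism_linear lphi 0 y.
  have := zmod_morphism_linear lphi y y.
  by rewrite !subrr => ->; rewrite !sub0r => <-; rewrite -(normrN y).
exists psi.
  apply: duality_mapping_young.
  have -> : psi g = `|g| ^+ 2.
    rewrite psiE; apply: (phiG0 (g, `|g| ^+ 2)); exists 1.
    by rewrite /= scale1r mul1r subrr.
  have : `|psi| ^+ 2 <= `|g| ^+ 2 by rewrite lerXn2r// nnegrE.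
  lra.
move=> w Ww; rewrite psiE; apply: (phiG0 (w, 0)); exists 0.
by rewrite /= scale0r subr0 mul0r.
Qed.

Lemma duality_mapping_neq0 Y (y : Y) : duality_mapping y !=set0.
Proof.
have [|a x z|w|phi phiy _] := @duality_mapping_annihilator Y [set 0] y.
- by [].
- by move=> -> ->; rewrite /= scaler0 addr0.
- by move=> ->; rewrite subr0.
- by exists phi.
Qed.

Lemma duality_mapping_evaluation Y (y : Y) (phi : cdual Y) :
  duality_mapping phi (bidual_embedding y) -> duality_mapping y phi.
Proof.
move=> evphi; apply: duality_mapping_young.
have nphi := duality_mapping_norm evphi.
(* Testing the evaluation at [y] on a functional dual to [y] bounds its norm below by [|y|]. *)
have [psi psiy] := duality_mapping_neq0 y.
have npsi := duality_mapping_norm psiy.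
have le_y : psi y <= `|bidual_embedding y| * `|psi|.
  exact: cdual_le_norm (bidual_embedding y) psi.
rewrite nphi npsi psiy.1 in le_y.
have -> : phi y = `|phi| ^+ 2 by exact: evphi.1.
suff : `|y| ^+ 2 <= `|phi| ^+ 2 by lra.
rewrite lerXn2r ?nnegrE//; have [->|y0] := eqVneq y 0; first by rewrite normr0.
by move: le_y; rewrite expr2 ler_pM2r// normr_gt0.
Qed.

Lemma duality_mapE Y (y : Y) (phi : cdual Y) : strictly_convex (cdual Y) ->
  duality_mapping y phi <-> duality_map y = phi.
Proof.
move=> cY; have Jy := getPex (duality_mapping_neq0 y).
by split=> [phiy|<- //]; exact: duality_mapping_unique cY Jy phiy.
Qed.

Lemma duality_map_invE Y (y : Y) (phi : cdual Y) : strictly_convex Y ->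
  strictly_convex (cdual Y) -> duality_mapping y phi ->
  duality_map_inv phi = y.
Proof.
move=> cY cY' phiy.
have : duality_map (duality_map_inv phi) = phi.
  by apply: (@getPex _ [set y | duality_map y = phi]); exists y;
    apply/duality_mapE.
by move/(duality_mapE _ _ cY') => h; exact: duality_mapping_inj cY h phiy.
Qed.

(** Surjectivity of the duality map: by reflexivity, an element of the bidual dual to [phi] is the
    evaluation at some [y], and [phi] is then dual to [y]. *)
Lemma duality_map_invK Y (phi : cdual Y) : strictly_convex Y ->
  strictly_convex (cdual Y) -> reflexive_space Y ->
  duality_mapping (duality_map_inv phi) phi.
Proof.
move=> cY cY' rY; have [Phi Phiphi] := duality_mapping_neq0 phi.
have : range (@bidual_embedding R Y) Phi by rewrite rY.
move=> [y _ yPhi]; move: Phiphi.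
rewrite -yPhi => /duality_mapping_evaluation phiy.
by rewrite (duality_map_invE cY cY' phiy).
Qed.

End duality_mapping.

(** * Residual minimizers, orthogonality and saddle points *)

Section petrov_galerkin.
Context (R : realType) (U V : normedModType R) (B : {linear U -> cdual V}).
Variables (f : cdual V) (W : set U) (u : U).
Hypothesis W0 : W 0.
Hypothesis W_linear : forall (a : R) x y, W x -> W y -> W (a *: x + y).
Hypothesis Wu : W u.

Lemma argmin_orthogonal : strictly_convex V -> strictly_convex (cdual V) ->
  reflexive_space (cdual V) -> reflexive_space V ->
  argmin W (fun w => `|f - B w|) u ->
  forall w, W w -> B w (duality_map_inv (f - B u)) = 0.
Proof.
move=> cV cV' rV' rV [_ minu].
have [||_ [w Ww <-]|Phi PhiJ PhiW] :=
    @duality_mapping_annihilator R (cdual V) (B @` W) (f - B u).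
- by exists 0 => //; rewrite linear0.
- move=> a _ _ [x Wx <-] [y Wy <-]; exists (a *: x + y); first exact: W_linear.
  by rewrite linearP.
- have := minu _ (W_linear 1 Ww Wu).
  by rewrite scale1r linearD opprD addrA addrAC.
move=> w Ww; have : range (@bidual_embedding R V) Phi by rewrite rV.
move=> [y _ yPhi]; rewrite -yPhi in PhiJ PhiW.
rewrite (duality_map_invE cV cV' (duality_mapping_evaluation PhiJ)).
exact: (PhiW (B w) (imageP B Ww)).
Qed.

Lemma unique_argmin r : bounded_below B -> strictly_convex (cdual V) ->
  duality_mapping r (f - B u) -> (forall w, W w -> B w r = 0) ->
  unique (argmin W (fun w => `|f - B w|)) u.
Proof.
move=> [gamma gamma0 Bgamma] cV' rJ Br.
have nr := duality_mapping_norm rJ.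
have fr w : W w -> (f - B w) r = `|r| ^+ 2.
  by move=> Ww; rewrite -rJ.1 [LHS]/(f r - B w r) [RHS]/(f r - B u r) !Br.
have minu w : W w -> `|f - B u| <= `|f - B w|.
  move=> Ww; rewrite nr; have [->|r0] := eqVneq r 0; first by rewrite normr0.
  have := cdual_le_norm (f - B w) r.
  by rewrite fr// expr2 ler_pM2r// normr_gt0.
split=> // w [Ww minw].
(* Two minimal residuals have equal norm [|r|], and their sum takes the value [2 * |r| ^+ 2] at
   [r]. *)
have Buw : f - B u = f - B w.
  apply: strictly_convex_eq => //.
    by apply/eqP; rewrite eq_le minu// minw.
  rewrite nr; have [->|r0] := eqVneq r 0; first by rewrite normr0 mulr0.
  rewrite -(@ler_pM2r _ `|r|) ?normr_gt0//.
  apply: le_trans (cdual_le_norm _ r).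
  rewrite [X in _ <= X]/((f - B u) r + (f - B w) r) !fr//.
  by rewrite -mulrA -expr2 mulr_natl mulr2n.
(* Bounded below, [B] is injective. *)
apply/eqP; rewrite -subr_eq0 -normr_le0 -(pmulr_rle0 _ gamma0).
apply: le_trans (Bgamma _) _; rewrite linearB.
by move/addrI/oppr_inj: Buw => ->; rewrite subrr normr0.
Qed.

(** The Lagrangian at [r] is constant in [w], and its increase from [r] to [v] at [u] is at least
    half of [(|r| - |v|) ^+ 2]. *)
Lemma duality_mapping_saddle_point r :
  duality_mapping r (f - B u) -> (forall w, W w -> B w r = 0) ->
  saddle_point setT W (lagrangian B f) r u.
Proof.
move=> rJ Br; split=> // v w _ Ww; rewrite /lagrangian !Br// lexx /= addr0.
have fB x : (f - B u) x = f x - B u x :> R by [].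
have := cdual_le_norm (f - B u) v; have := rJ.1.
rewrite (duality_mapping_norm rJ) !fB Br// subr0 => -> le.
have := sqr_ge0 (`|r| - `|v|); rewrite sqrrB => sq.
have {}le : f v - B u v <= `|r| * `|v| :> R by [].
lra.
Qed.

Lemma saddle_point_duality_mapping r : strictly_convex V ->
  strictly_convex (cdual V) -> reflexive_space V ->
  saddle_point setT W (lagrangian B f) r u ->
  duality_mapping r (f - B u) /\ (forall w, W w -> B w r = 0).
Proof.
move=> cV cV' rV [_ _ sp].
have Br w : W w -> B w r = 0.
  (* Maximality at [u] is tested in the directions [w] and [- w]. *)
  move=> Ww; have le a : a * B w r <= 0 :> R.
    have /andP[+ _] := sp r _ I (W_linear a Ww Wu).
    have BE : B (a *: w + u) r = a * B w r + B u r :> R by rewrite linearP.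
    by rewrite /lagrangian BE lerD2l gerDr.
  have := le 1; have := le (-1); rewrite mulN1r mul1r oppr_le0 => h1 h2.
  by apply/eqP; rewrite eq_le h1 h2.
split=> //; apply: duality_mapping_young.
have fB x : (f - B u) x = f x - B u x :> R by [].
(* At the vector [y] dual to [f - B u] the Lagrangian equals minus half of [|f - B u| ^+ 2];
   minimality of [r] against [y] is the reverse Young inequality. *)
have yJ := duality_map_invK (f - B u) cV cV' rV.
set y := duality_map_inv _ in yJ.
have /andP[_] := sp y _ I Wu.
rewrite /lagrangian (duality_mapping_norm yJ) fB.
have := yJ.1; rewrite fB => e1 e2.
have {}e1 : f y - B u y = `|y| ^+ 2 :> R by [].
have {}e2 : 2^-1 * `|r| ^+ 2 - f r + B u r <=
    2^-1 * `|y| ^+ 2 - f y + B u y :> R.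
  by [].
lra.
Qed.

End petrov_galerkin.

Theorem theorem3 (R : realType) (U V : completeNormedModType R)
  (B : {linear U -> cdual V})
  (B_continuous : continuous B) (B_bounded_below : bounded_below B)
  (V_convex : strictly_convex V) (V_reflexive : reflexive_space V)
  (dualV_convex : strictly_convex (cdual V))
  (dualV_reflexive : reflexive_space (cdual V))
  (f : cdual V) (Un : set U) (Un_subspace : fin_dim_subspace Un)
  (un : U) (un_in : Un un) :
  [<-> (* (i) *)
       unique (argmin Un (fun wn => `|f - B wn|)) un;
       (* (ii) *)
       forall nun : cdual V, (B @` Un) nun ->
         nun (duality_map_inv (f - B un)) = 0;
       (* (iii) *)
       exists! r : V,
         (forall v : V, duality_map r v + B un v = f v) /\
         (forall wn : U, Un wn -> B wn r = 0);
       (* (iv) *)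
       lagrange_multiplier B f Un un].
Proof.
have [Un0 Un_linear _] := Un_subspace.
have residualP r : duality_mapping r (f - B un) <->
    forall v, duality_map r v + B un v = f v.
  rewrite duality_mapE//; split=> [-> v|rE].
    by rewrite [(f - B un) v]/(f v - B un v) subrK.
  by apply/val_inj/funext => v; exact: (canRL (addrK _) (rE v)).
tfae.
- move=> [min_un _] _ [wn Unwn <-].
  exact: argmin_orthogonal min_un _ Unwn.
- move=> orth; exists (duality_map_inv (f - B un)).
  split=> [|r [/residualP rJ _]].
    split; first by apply/residualP/duality_map_invK.
    by move=> wn Unwn; apply: orth; exists wn.
  (* Uniqueness of [r]: strict convexity of [V] makes the duality map injective. *)
  exact: duality_map_invE.
- move=> [r [[/residualP rJ Br] _]]; exists r.
  exact: duality_mapping_saddle_point.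
- move=> [r sp].
  have [//|//|//|//|rJ Br] := saddle_point_duality_mapping Un_linear _ _ _ _ sp.
  exact: unique_argmin rJ Br.
Qed.
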